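(* There is an absolute constant $c$ (independent of $d$) such that for every $d$, every $n\ge 2d$, and every set $H$ of $n$ hyperplanes in $\mathbb{R}^d$ (in generic coordinate position), the number of prisms of all dimensions in the vertical decomposition $\mathrm{VD}(H)$ of $\mathcal{A}(H)$ is at most $c\,\frac{4^d}{d^{7/2}}\,n^{2d}$.
   Context: Vertical decomposition $\mathrm{VD}$ of a convex polyhedron $C\subseteq\mathbb{R}^d$ is defined recursively on $d$. First stage: for a facet $f^+$ of the upper boundary and a facet $f^-$ of the lower boundary of $C$ (with respect to $x_d$), whose vertical projections onto $x_d=0$ overlap in a $(d-1)$-dimensional set $P$, form the prism $\{p\in C:\text{projection of }p\in P\}$. Unbounded cells may give prisms with only a floor or only a ceiling. Recursion: vertically decompose $P\subseteq\mathbb{R}^{d-1}$ recursively and lift the resulting prisms back. Base case: in dimension 1 an interval is its own decomposition. $\mathrm{VD}(H)$ is the union of the decompositions of all cells, of every dimension, of $\mathcal{A}(H)$. A $j$-dimensional cell is decomposed within its supporting $j$-flat with generic coordinates. Generic position means no intersection flat is parallel to a coordinate axis. *)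

(* Defs.v *)
From HB Require Import structures.
From mathcomp Require Import all_boot all_order all_algebra.
Set Implicit Arguments. Unset Strict Implicit. Unset Printing Implicit Defensive.
Import Order.TTheory GRing.Theory Num.Theory.
Local Open Scope ring_scope.

Section Geometry.
Variable R : rcfType.

Definition dot (k : nat) (u x : 'rV[R]_k) : R := \sum_(i < k) u 0 i * x 0 i.

Definition proj (k : nat) (x : 'rV[R]_k.+1) : 'rV[R]_k :=
  \row_(i < k) x 0 (widen_ord (leqnSn k) i).
Definition lastc (k : nat) (x : 'rV[R]_k.+1) : R := x 0 ord_max.

Definition projS (k : nat) (F : 'rV[R]_k.+1 -> Prop) (y : 'rV[R]_k) : Prop :=
  exists p, F p /\ proj p = y.

Definition closure (k : nat) (C : 'rV[R]_k -> Prop) (p : 'rV[R]_k) : Prop :=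
  forall eps : R, 0 < eps -> exists q : 'rV[R]_k, C q /\ forall i, `|p 0 i - q 0 i| < eps.
Definition has_interior (k : nat) (P : 'rV[R]_k -> Prop) : Prop :=
  exists x : 'rV[R]_k, exists2 eps : R, 0 < eps &
    forall y : 'rV[R]_k, (forall i, `|y 0 i - x 0 i| < eps) -> P y.

(* f is a facet of the upper boundary of C (w.r.t. the last coordinate):
   f is the contact set of cl C with a non-vertical supporting hyperplane
   x_{k+1} = c.x' + c0 lying above C, and f is (k)-dimensional, i.e. its
   vertical projection has nonempty interior. *)
Definition upper_facet (k : nat) (C f : 'rV[R]_k.+1 -> Prop) : Prop :=
  exists (c : 'rV[R]_k) (c0 : R),
    (forall p, C p -> lastc p <= dot c (proj p) + c0) /\
    (forall p, f p <-> (closure C p /\ lastc p = dot c (proj p) + c0)) /\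
    has_interior (projS f).
Definition lower_facet (k : nat) (C f : 'rV[R]_k.+1 -> Prop) : Prop :=
  exists (c : 'rV[R]_k) (c0 : R),
    (forall p, C p -> dot c (proj p) + c0 <= lastc p) /\
    (forall p, f p <-> (closure C p /\ lastc p = dot c (proj p) + c0)) /\
    has_interior (projS f).

(* a "ceiling" is an upper facet; if C has no upper facet at all (C unbounded
   upward) the ceiling is absent, which we encode by taking cl C itself, so
   that the projection constraint it imposes is vacuous. Same for floors. *)
Definition ceiling (k : nat) (C F : 'rV[R]_k.+1 -> Prop) : Prop :=
  upper_facet C F \/
  ((~ exists f, upper_facet C f) /\ forall p, F p <-> closure C p).
Definition floor (k : nat) (C F : 'rV[R]_k.+1 -> Prop) : Prop :=
  lower_facet C F \/
  ((~ exists f, lower_facet C f) /\ forall p, F p <-> closure C p).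

Definition vd_step (k' : nat)
    (rec : ('rV[R]_k' -> Prop) -> ('rV[R]_k' -> Prop) -> Prop)
    (C S : 'rV[R]_k'.+1 -> Prop) : Prop :=
  if k' == 0%N then (forall p, S p <-> C p)
  else exists Fu Fl : 'rV[R]_k'.+1 -> Prop,
    ceiling C Fu /\ floor C Fl /\
    let P := fun y => projS Fu y /\ projS Fl y in
    has_interior P /\
    exists Q : 'rV[R]_k' -> Prop, rec P Q /\
      (forall p, S p <-> (C p /\ Q (proj p))).

(* vd k C S : S is a prism of the vertical decomposition of the convex
   polyhedron C in R^k.  Dimension 0: a point is its own prism. *)
Fixpoint vd (k : nat) : ('rV[R]_k -> Prop) -> ('rV[R]_k -> Prop) -> Prop :=
  match k return ('rV[R]_k -> Prop) -> ('rV[R]_k -> Prop) -> Prop with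
  | 0 => fun C S => forall p, S p <-> C p
  | k'.+1 => fun C S => @vd_step k' (@vd k') C S
  end.

Definition is_frame (j d : nat) (phi : 'rV[R]_j -> 'rV[R]_d)
    (F : 'rV[R]_d -> Prop) : Prop :=
  exists (p0 : 'rV[R]_d) (v : 'I_j -> 'rV[R]_d),
    (forall y, phi y = p0 + \sum_(k < j) y 0 k *: v k) /\
    (forall y : 'rV[R]_j, \sum_(k < j) y 0 k *: v k = 0 -> y = 0) /\
    (forall x, F x <-> exists y, phi y = x).

Definition unitv (k : nat) (m : 'I_k) : 'rV[R]_k := \row_(i < k) (i == m)%:R.
Definition parallel_axis (k : nat) (G : 'rV[R]_k -> Prop) (m : 'I_k) : Prop :=
  exists y, forall t : R, G (y + t *: unitv m).

Section Arrangement.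
Variables (d n : nat) (a : 'I_n -> 'rV[R]_d) (b : 'I_n -> R).
Definition hyp (i : 'I_n) (x : 'rV[R]_d) : Prop := dot (a i) x = b i.

Definition generic : Prop :=
  forall S : {set 'I_n}, S != set0 -> forall m : 'I_d,
    ~ parallel_axis (fun x => forall i, i \in S -> hyp i x) m.

(* cells of A(H): classes of points with equal sign vectors (relatively open
   faces of every dimension) *)
Definition cell_of (x y : 'rV[R]_d) : Prop :=
  forall i, Num.sg (dot (a i) y - b i) = Num.sg (dot (a i) x - b i).
Definition zset (x : 'rV[R]_d) : {set 'I_n} := [set i | dot (a i) x == b i].
Definition flatZ (Z : {set 'I_n}) (y : 'rV[R]_d) : Prop :=
  forall i, i \in Z -> hyp i y.

(* a frame phi of flat(Z) is generic if the arrangement induced on the flat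
   by the other hyperplanes, in the coordinates of phi, is in generic
   coordinate position *)
Definition frame_generic (j : nat) (Z : {set 'I_n})
    (phi : 'rV[R]_j -> 'rV[R]_d) : Prop :=
  forall S : {set 'I_n}, S != set0 -> S \subset ~: Z -> forall m : 'I_j,
    ~ parallel_axis (fun y => forall i, i \in S -> hyp i (phi y)) m.

(* fr j Z : the coordinate frame (from R^j) chosen for the supporting flat of
   the lower-dimensional cells with zero set Z *)
Definition good_frames
    (fr : forall j : nat, {set 'I_n} -> 'rV[R]_j -> 'rV[R]_d) : Prop :=
  forall (x : 'rV[R]_d) (j : nat), zset x != set0 ->
    (exists phi : 'rV[R]_j -> 'rV[R]_d, is_frame phi (flatZ (zset x))) ->
    is_frame (fr j (zset x)) (flatZ (zset x)) /\
    frame_generic (zset x) (fr j (zset x)).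

(* S is a prism of VD(H): a prism of the decomposition of some cell of some
   dimension (full-dimensional cells in the original coordinates, lower-
   dimensional ones within their supporting flat in the chosen frame). *)
Definition VD_prism (fr : forall j : nat, {set 'I_n} -> 'rV[R]_j -> 'rV[R]_d)
    (S : 'rV[R]_d -> Prop) : Prop :=
  exists x : 'rV[R]_d,
    (zset x = set0 /\ vd (cell_of x) S) \/
    (zset x != set0 /\ exists j : nat,
       is_frame (fr j (zset x)) (flatZ (zset x)) /\
       exists Q : 'rV[R]_j -> Prop,
         vd (fun y => cell_of x (fr j (zset x) y)) Q /\
         forall p, S p <-> exists y, Q y /\ fr j (zset x) y = p).

Definition num_prisms_le (fr : forall j : nat, {set 'I_n} -> 'rV[R]_j -> 'rV[R]_d)
    (B : R) : Prop :=
  forall (m : nat) (P : 'I_m -> ('rV[R]_d -> Prop)),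
    (forall k, VD_prism fr (P k)) ->
    (forall k l, k != l -> ~ (forall p, P k p <-> P l p)) ->
    (m%:R : R) <= B.
End Arrangement.
End Geometry.

(* Main.v *)
(** A prism is determined by few signed hyperplanes.  A cell is given by affine
    constraints, one per hyperplane and sign.  Choosing the ceiling and the floor
    of a prism picks at most two constraints, an unordered pair with two signs,
    and the projected region [P] is again given by at most one constraint per
    hyperplane: an upper constraint matters only on the ceiling and a lower one
    only on the floor.  So [d] steps give at most [(2 n^2 + 1)^d] prisms in the
    full-dimensional cells.  For a cell in a flat of codimension [c], the first
    [c] of the [d] steps name instead hyperplanes cutting out the flat, and in
    total there are at most [(2 n^2 + n + 1)^d <= 2 2^d n^(2d)] prisms for
    [n >= 2d].  The factor [2^d] beats the required [4^d / d^(7/2)]. *)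

Require Import Defs.
From HB Require Import structures.
From mathcomp Require Import all_boot all_order all_algebra.
From mathcomp Require Import ring lra zify.
From Stdlib Require Import Classical.
Set Implicit Arguments. Unset Strict Implicit. Unset Printing Implicit Defensive.
Import Order.TTheory GRing.Theory Num.Theory.
Local Open Scope ring_scope.

(** * Affine functions and their behaviour on small boxes *)

Definition affine (R : rcfType) (k : nat) : Type := ('rV[R]_k * R)%type.

Section AffineFunctions.
Variable R : rcfType.
Implicit Types k : nat.

Definition eval k (f : affine R k) (x : 'rV[R]_k) : R := dot f.1 x + f.2.

Lemma dotE k (u x : 'rV[R]_k) : dot u x = (u *m x^T) 0 0.
Proof. by rewrite mxE; apply: eq_bigr => i _; rewrite mxE. Qed.

Lemma dotDr k (u x y : 'rV[R]_k) : dot u (x + y) = dot u x + dot u y.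
Proof. by rewrite !dotE linearD mulmxDr mxE. Qed.

Lemma dotZr k a (u x : 'rV[R]_k) : dot u (a *: x) = a * dot u x.
Proof. by rewrite !dotE linearZ -scalemxAr mxE. Qed.

Lemma dotDl k (u v x : 'rV[R]_k) : dot (u + v) x = dot u x + dot v x.
Proof. by rewrite !dotE mulmxDl mxE. Qed.

Lemma dotZl k a (u x : 'rV[R]_k) : dot (a *: u) x = a * dot u x.
Proof. by rewrite !dotE -scalemxAl mxE. Qed.

Lemma dot0l k (x : 'rV[R]_k) : dot 0 x = 0.
Proof. by rewrite dotE mul0mx mxE. Qed.

Lemma dotBr k (u x y : 'rV[R]_k) : dot u (x - y) = dot u x - dot u y.
Proof. by rewrite -scaleN1r dotDr dotZr mulN1r. Qed.

Lemma dot_unitv k (u : 'rV[R]_k) m : dot u (unitv R m) = u 0 m.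
Proof.
rewrite /dot (bigD1 m) //= big1 => [|i /negPf im].
  by rewrite mxE eqxx mulr1 addr0.
by rewrite mxE im mulr0.
Qed.

Lemma evalB k (f : affine R k) x y : eval f x - eval f y = dot f.1 (x - y).
Proof. by rewrite /eval dotBr; ring. Qed.

Lemma eval_lin k (f : affine R k) x y t :
  eval f (x + t *: (y - x)) = (1 - t) * eval f x + t * eval f y.
Proof. by rewrite /eval dotDr dotZr dotBr; ring. Qed.

Lemma eval_dist k (f : affine R k) (x y : 'rV[R]_k) eps :
  (forall i, `|y 0 i - x 0 i| < eps) ->
  `|eval f y - eval f x| <= eps * \sum_i `|f.1 0 i|.
Proof.
move=> near_xy; rewrite evalB /dot mulr_sumr.
apply: le_trans (ler_norm_sum _ _ _) _; apply: ler_sum => i _.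
rewrite !mxE normrM mulrC ler_wpM2r // ltW //; exact: near_xy.
Qed.

Definition lincomb k (f : affine R k) (a : R) (g : affine R k) : affine R k :=
  (f.1 + a *: g.1, f.2 + a * g.2).

Lemma eval_lincomb k (f : affine R k) a g x :
  eval (lincomb f a g) x = eval f x + a * eval g x.
Proof. by rewrite /eval /= dotDl dotZl; ring. Qed.

Lemma eval_const k (f : affine R k) x y : f.1 = 0 -> eval f x = eval f y.
Proof. by rewrite /eval => ->; rewrite !dot0l. Qed.

Lemma finite_pos_lb (I : finType) (e : I -> R) :
  (forall i, 0 < e i) -> exists2 e0, 0 < e0 & forall i, e0 <= e i.
Proof.
move=> e_gt0; have S_ge0 : 0 <= \sum_i (e i)^-1.
  by apply: sumr_ge0 => i _; rewrite invr_ge0 ltW.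
(* This replaces the minimum of the [e i] and stays positive when [I] is empty. *)
exists (1 + \sum_i (e i)^-1)^-1; first by rewrite invr_gt0; lra.
move=> i; rewrite -[leRHS]invrK lef_pV2 ?posrE ?invr_gt0 //; last by lra.
rewrite (bigD1 i) //= addrCA lerDl addr_ge0 // sumr_ge0 // => j _.
by rewrite invr_ge0 ltW.
Qed.

Lemma eval_pos_near k (f : affine R k) (x : 'rV[R]_k) : 0 < eval f x ->
  exists2 e, 0 < e & forall y : 'rV[R]_k, (forall i, `|y 0 i - x 0 i| < e) -> 0 < eval f y.
Proof.
move=> fx; set M := \sum_i `|f.1 0 i|.
have M_ge0 : 0 <= M by apply: sumr_ge0.
exists (eval f x / (M + 1)); first by rewrite divr_gt0 //; lra.
move=> y /(eval_dist f); rewrite -/M => /ler_normlP [le1 _].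
have : eval f x / (M + 1) * M < eval f x.
  by rewrite mulrAC ltr_pdivrMr ?ltr_pM2l //; lra.
by lra.
Qed.

Lemma evals_pos_near k (I : finType) (f : I -> affine R k) (x : 'rV[R]_k) :
  (forall i, 0 < eval (f i) x) ->
  exists2 e, 0 < e &
    forall y : 'rV[R]_k, (forall i, `|y 0 i - x 0 i| < e) -> forall i, 0 < eval (f i) y.
Proof.
move=> fx.
have /fin_all_exists [e eP] i : exists e, 0 < e /\
    forall y : 'rV[R]_k, (forall j, `|y 0 j - x 0 j| < e) -> 0 < eval (f i) y.
  by have [e e0 eP] := eval_pos_near (fx i); exists e.
have [e0 e0_gt0 le_e0] := finite_pos_lb (fun i => (eP i).1).
exists e0 => // y xy i; apply: (eP i).2 => j.
exact: lt_le_trans (xy j) (le_e0 i).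
Qed.

Lemma eval_closure k (f : affine R k) (C : 'rV[R]_k -> Prop) (p : 'rV[R]_k) :
  (forall q, C q -> 0 <= eval f q) -> Defs.closure C p -> 0 <= eval f p.
Proof.
move=> fC clp; rewrite leNgt; apply/negP => fp.
have gp : 0 < eval (lincomb (0, 0) (-1) f) p.
  by rewrite eval_lincomb /eval dot0l /= -/(eval f p); lra.
have [e e_gt0 eP] := eval_pos_near gp.
have [q [Cq qp]] := clp _ e_gt0.
have /eP : forall i, `|q 0 i - p 0 i| < e by move=> i; rewrite distrC.
by rewrite eval_lincomb /eval dot0l /=; have := fC q Cq; rewrite /eval; lra.
Qed.

(** Moving by [e / 2] in both directions along an axis changes [f] by opposite amounts, so each
    coefficient vanishes. *)
Lemma eval_zero_min k (f : affine R k) (x : 'rV[R]_k) e : 0 < e ->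
  (forall y : 'rV[R]_k, (forall i, `|y 0 i - x 0 i| < e) -> 0 <= eval f y) ->
  eval f x = 0 -> f.1 = 0 /\ f.2 = 0.
Proof.
move=> e_gt0 f_ge0 fx.
have f1 : f.1 = 0.
  apply/rowP => m; rewrite mxE.
  have fe t : `|t| < e -> 0 <= t * f.1 0 m.
    move=> te; have -> : t * f.1 0 m = eval f (x + t *: unitv R m).
      rewrite -[RHS]subr0 -fx evalB addrC addrA addNr add0r.
      by rewrite dotZr dot_unitv.
    apply: f_ge0 => i; rewrite !mxE [x 0 i + _]addrC addrK normrM.
    by case: (i == m); rewrite ?normr1 ?normr0 ?mulr1 ?mulr0.
  have e2 : `|e / 2| < e by rewrite ger0_norm; lra.
  have := fe (e / 2) e2; have := fe (- (e / 2)); rewrite normrN => /(_ e2).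
  rewrite mulNr oppr_ge0 => le0 ge0.
  have /eqP : e / 2 * f.1 0 m = 0 by lra.
  by rewrite mulf_eq0 => /orP [/eqP|/eqP //]; lra.
by split => //; move: fx; rewrite /eval f1 dot0l add0r.
Qed.

(** Induction on the list: either the current minimizer stays below the new function on the whole
    box, or the new one is strictly smaller at some point and then, by continuity, on a smaller box
    around it. This is what gives a facet a projection with interior. *)
Lemma min_on_subbox k (I : eqType) (h : I -> affine R k) (s : seq I) i0
    (x0 : 'rV[R]_k) (e0 : R) :
  0 < e0 -> exists u (x : 'rV[R]_k) (e : R), [/\ u \in i0 :: s, 0 < e,
    forall y : 'rV[R]_k, (forall i, `|y 0 i - x 0 i| < e) -> forall i, `|y 0 i - x0 0 i| < e0
    & forall j (y : 'rV[R]_k), j \in i0 :: s -> (forall i, `|y 0 i - x 0 i| < e) ->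
       eval (h u) y <= eval (h j) y].
Proof.
move=> e0_gt0; elim: s => [|j s [u [x [e [us e_gt0 sub uP]]]]].
  exists i0, x0, e0; split => //; first by rewrite mem_head.
  by move=> j y; rewrite inE => /eqP ->.
have mem_mid a : (a \in [:: i0, j & s]) = (a == j) || (a \in i0 :: s).
  by rewrite !inE orbCA.
case: (classic (forall y : 'rV[R]_k, (forall i, `|y 0 i - x 0 i| < e) ->
                  eval (h u) y <= eval (h j) y)) => [keep|].
  exists u, x, e; split => //; first by rewrite mem_mid us orbT.
  move=> a y; rewrite mem_mid => /orP ai yx.
  by case: ai => [/eqP ->|ai]; [exact: keep | exact: uP].
move=> /not_all_ex_not [y not_le]; have [yx /negP] := imply_to_and _ _ not_le.
rewrite -ltNge => lt_ju.
have d0 : 0 < eval (lincomb (h u) (-1) (h j)) y.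
  by rewrite eval_lincomb; lra.
have [e1 e1_gt0 e1P] := eval_pos_near d0.
have [e2 e2_gt0 e2P] := finite_pos_lb
  (fun i : 'I_k => etrans (subr_gt0 _ _) (yx i)).
pose e3 := Num.min e1 e2.
have e3_gt0 : 0 < e3 by rewrite lt_min e1_gt0.
have sub3 z : (forall i, `|z 0 i - y 0 i| < e3) ->
    (forall i, `|z 0 i - y 0 i| < e1) /\ (forall i, `|z 0 i - x 0 i| < e).
  move=> zy; split => i; have := zy i; rewrite lt_min => /andP [] // _ lt2.
  have le2 := e2P i; apply: le_lt_trans (ler_distD (y 0 i) _ _) _.
  by lra.
exists j, y, e3; split => // [|z /sub3 [_ zx]|a z].
- by rewrite mem_mid eqxx.
- exact: sub.
rewrite mem_mid => /orP [/eqP -> //|ai] /sub3 [/e1P + zx].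
by rewrite eval_lincomb; have := uP a z ai zx; lra.
Qed.

End AffineFunctions.

(** * The last coordinate, closures of polyhedra, and facets as tight constraints *)

Section LastCoordinate.
Variable R : rcfType.
Implicit Types k : nat.

Definition lift_pt k (y : 'rV[R]_k) (t : R) : 'rV[R]_k.+1 :=
  \row_(i < k.+1) if insub (val i) is Some j then y 0 j else t.

Lemma proj_lift k (y : 'rV[R]_k) t : proj (lift_pt y t) = y.
Proof.
apply/rowP => i; rewrite !mxE /=.
by case: insubP => [j _ /ord_inj ->|]; rewrite ?ltn_ord.
Qed.

Lemma lastc_lift k (y : 'rV[R]_k) t : lastc (lift_pt y t) = t.
Proof. by rewrite /lastc mxE /= insubF ?ltnn. Qed.

Lemma lift_proj k (p : 'rV[R]_k.+1) : lift_pt (proj p) (lastc p) = p.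
Proof.
apply/rowP => i; rewrite mxE; case: insubP => [j _ ji|].
  by rewrite mxE; congr (p _ _); apply: val_inj.
rewrite -leqNgt => ki; congr (p _ _); apply: val_inj => /=.
by apply/eqP; rewrite eqn_leq ki -ltnS ltn_ord.
Qed.

Definition lcoef k (f : affine R k.+1) : R := lastc f.1.
Definition restr k (f : affine R k.+1) : affine R k := (proj f.1, f.2).

Lemma eval_split k (f : affine R k.+1) p :
  eval f p = eval (restr f) (proj p) + lcoef f * lastc p.
Proof.
rewrite /eval /dot big_ord_recr /= addrAC; congr (_ + _ + _).
by apply: eq_bigr => i _; rewrite !mxE.
Qed.

Lemma eval_lift k (f : affine R k.+1) y t :
  eval f (lift_pt y t) = eval (restr f) y + lcoef f * t.
Proof. by rewrite eval_split proj_lift lastc_lift. Qed.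

(* [subst f g] is [f] on the graph [g = 0], seen as a function of the
   projection (meaningful only when [lcoef g != 0]). *)
Definition subst k (f g : affine R k.+1) : affine R k :=
  lincomb (restr f) (- (lcoef f / lcoef g)) (restr g).

Lemma eval_subst k (f g : affine R k.+1) p : lcoef g != 0 ->
  eval f p = eval (subst f g) (proj p) + lcoef f / lcoef g * eval g p.
Proof.
by move=> g0; rewrite eval_lincomb !(eval_split _ p); field.
Qed.

Definition height k (g : affine R k.+1) y : R := - eval (restr g) y / lcoef g.

Lemma eval_height k (g : affine R k.+1) y : lcoef g != 0 ->
  eval g (lift_pt y (height g y)) = 0.
Proof. by move=> g0; rewrite eval_lift /height; field. Qed.

Lemma eval_on_height k (f g : affine R k.+1) y : lcoef g != 0 ->
  eval f (lift_pt y (height g y)) = eval (subst f g) y.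
Proof. by move=> g0; rewrite (eval_subst f _ g0) eval_height // proj_lift; ring. Qed.

Lemma eval0_height k (g : affine R k.+1) p : lcoef g != 0 ->
  eval g p = 0 -> p = lift_pt (proj p) (height g (proj p)).
Proof.
move=> g0 gp; rewrite -{1}[p]lift_proj; congr lift_pt.
move: gp; rewrite eval_split => gp.
by apply: (mulfI g0); rewrite /height [RHS]mulrC divfK //; lra.
Qed.

(** One flag treats together the open cells ([b = true]) and the closed projections of the later
    stages ([b = false]). *)
Definition cmp0 (b : bool) (x : R) : bool := if b then 0 < x else 0 <= x.

Lemma cmp0W b x : cmp0 b x -> 0 <= x.
Proof. by case: b => //= /ltW. Qed.

Lemma cmp0_convex b x y t : 0 <= x -> cmp0 b y -> 0 < t <= 1 ->
  cmp0 b ((1 - t) * x + t * y).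
Proof.
move=> x0; case: b => /= y0 /andP [t0 t1].
  by rewrite ltr_wpDl ?mulr_gt0 ?mulr_ge0 //; lra.
by rewrite addr_ge0 ?mulr_ge0 //; lra.
Qed.

Definition polyhedron k (I : Type) b (f : I -> affine R k) (C : 'rV[R]_k -> Prop) : Prop :=
  forall p, C p <-> forall i, cmp0 b (eval (f i) p).

Lemma closure_polyhedron k (I : finType) b (f : I -> affine R k) C x p :
  polyhedron b f C -> C x ->
  (Defs.closure C p <-> forall i, 0 <= eval (f i) p).
Proof.
move=> polyC Cx; split => [clp i|fp eps eps_gt0].
  by apply: eval_closure clp => q /polyC /(_ i) /cmp0W.
set M := \sum_i `|p 0 i - x 0 i|.
have M_ge0 : 0 <= M by apply: sumr_ge0.
(* [p] is approached along the segment to [x]; this [t] is at most one and moves every coordinate by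
   less than [eps]. *)
pose t := eps / (eps + M + 1).
have den_gt0 : 0 < eps + M + 1 by lra.
have t_gt0 : 0 < t by rewrite divr_gt0.
have t_le1 : t <= 1 by rewrite ler_pdivrMr //; lra.
have tM : t * M < eps.
  rewrite mulrAC ltr_pdivrMr // ltr_pM2l //; lra.
exists (p + t *: (x - p)); split.
  apply/polyC => i; rewrite eval_lin; apply: cmp0_convex; rewrite ?t_gt0 //.
  by move/polyC: Cx; apply.
move=> i; apply: le_lt_trans tM; rewrite !mxE.
have -> : p 0 i - (p 0 i + t * (x 0 i - p 0 i)) = t * (p 0 i - x 0 i) by ring.
rewrite normrM (gtr0_norm t_gt0) ler_pM2l // /M (bigD1 i) //= lerDl.
exact: sumr_ge0.
Qed.

Lemma interior_pt k (C : 'rV[R]_k -> Prop) (x : 'rV[R]_k) (eps : R) : 0 < eps ->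
  (forall y : 'rV[R]_k, (forall i, `|y 0 i - x 0 i| < eps) -> C y) -> C x.
Proof. by move=> e0; apply => i; rewrite subrr normr0. Qed.

(* [s = 1] gives upper facets and [s = -1] gives lower facets. *)
Definition side_facet k (s : R) (C F : 'rV[R]_k.+1 -> Prop) : Prop :=
  exists (c : 'rV[R]_k) (c0 : R),
    (forall p, C p -> s * lastc p <= s * (dot c (proj p) + c0)) /\
    (forall p, F p <-> (Defs.closure C p /\ lastc p = dot c (proj p) + c0)) /\
    has_interior (projS F).

Lemma upper_facetE k (C F : 'rV[R]_k.+1 -> Prop) : upper_facet C F <-> side_facet 1 C F.
Proof.
by split=> -[c [c0 [H1 H2]]]; exists c, c0; split=> // p /H1; rewrite !mul1r.
Qed.

Lemma lower_facetE k (C F : 'rV[R]_k.+1 -> Prop) : lower_facet C F <-> side_facet (-1) C F.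
Proof.
by split=> -[c [c0 [H1 H2]]]; exists c, c0; split=> // p /H1; rewrite !mulN1r lerN2.
Qed.

(** Some constraint of side [s] vanishes on the supporting hyperplane above the interior point [y0].
    Being nonnegative there over a box, it vanishes on the whole hyperplane, so its zero set is that
    hyperplane. *)
Lemma side_facet_label k (I : finType) b (f : I -> affine R k.+1) C x s F :
  s ^+ 2 = 1 -> polyhedron b f C -> C x -> side_facet s C F ->
  exists2 i, s * lcoef (f i) < 0 &
    forall p, F p <-> (forall j, 0 <= eval (f j) p) /\ eval (f i) p = 0.
Proof.
move=> s2 polyC Cx [c [c0 [le_u [FP [y0 [e e_gt0 eP]]]]]].
pose u y := dot c y + c0.
have clC p := closure_polyhedron p polyC Cx.
pose h i : affine R k := lincomb (restr (f i)) (lcoef (f i)) (c, c0).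
have hE i y : eval (h i) y = eval (f i) (lift_pt y (u y)).
  by rewrite eval_lincomb eval_lift.
have h_ge0 i (y : 'rV[R]_k) : (forall j, `|y 0 j - y0 0 j| < e) -> 0 <= eval (h i) y.
  move/eP => [p [/FP [/clC clp lp] py]]; rewrite hE -py /u -lp lift_proj.
  exact: clp.
have yy0 j : `|y0 0 j - y0 0 j| < e by rewrite subrr normr0.
case: (boolP [exists i, (s * lcoef (f i) < 0) && (eval (h i) y0 == 0)]).
  move=> /existsP [i /andP [si /eqP hi0]]; exists i => // p.
  have [h1 h2] := eval_zero_min e_gt0 (h_ge0 i) hi0.
  have li : lcoef (f i) != 0 by apply: contraTneq si => ->; rewrite mulr0 ltxx.
  have hu y : eval (restr (f i)) y + lcoef (f i) * u y = 0.
    by have := eval_lincomb (restr (f i)) (lcoef (f i)) (c, c0) y;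
      rewrite /eval h1 h2 dot0l /u /eval /=; lra.
  rewrite FP clC eval_split; split => -[clp]; first by move=> ->; have := hu (proj p).
  move=> e0; split=> //; apply: (mulfI li); have := hu (proj p); rewrite /u; lra.
rewrite negb_exists => /forallP noi.
(* If no constraint of side [s] is tight above [y0], a small move in direction [s] stays in the
   closure of [C] but crosses the supporting hyperplane. *)
have /fin_all_exists [d dP] i : exists d, 0 < d /\
   forall t, 0 < t <= d -> 0 <= eval (f i) (lift_pt y0 (u y0 + s * t)).
  have := noi i; rewrite negb_and -leNgt; case: (ltP (s * lcoef (f i)) 0) => /= [si hi|si _].
    have {}hi : 0 < eval (h i) y0 by rewrite lt_neqAle eq_sym hi h_ge0.
    exists (eval (h i) y0 / - (s * lcoef (f i))); split; first by rewrite divr_gt0 ?oppr_gt0.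
    move=> t /andP [t0]; rewrite ler_pdivlMr ?oppr_gt0 // => le_t.
    by move: le_t; rewrite hE !eval_lift; lra.
  exists 1; split => // t /andP [t0 _].
  have := h_ge0 i y0 yy0; rewrite hE !eval_lift.
  have : 0 <= s * lcoef (f i) * t by rewrite mulr_ge0 // ltW.
  by lra.
have [t t_gt0 tP] := finite_pos_lb (fun i => (dP i).1).
have /clC clp : forall i, 0 <= eval (f i) (lift_pt y0 (u y0 + s * t)).
  by move=> i; apply: (dP i).2; rewrite t_gt0 tP.
pose g : affine R k.+1 := (lift_pt (s *: c) (- s), s * c0).
have gE p : eval g p = s * (dot c (proj p) + c0) - s * lastc p.
  rewrite eval_split /eval /restr /lcoef /= proj_lift lastc_lift dotZl; ring.
have : 0 <= eval g (lift_pt y0 (u y0 + s * t)).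
  by apply: eval_closure clp => q /le_u; rewrite gE subr_ge0.
rewrite gE proj_lift lastc_lift -/(u y0).
have -> : s * u y0 - s * (u y0 + s * t) = - (s ^+ 2 * t) by ring.
by rewrite s2; lra.
Qed.

(** Above a small box inside the projection of [C] a single constraint of side [s] is extreme
    throughout, and its contact set is a facet. *)
Lemma side_facet_exists k (I : finType) b (f : I -> affine R k.+1) C s i0 :
  s ^+ 2 = 1 -> polyhedron b f C -> has_interior C -> s * lcoef (f i0) < 0 ->
  exists F, side_facet s C F.
Proof.
move=> s2 polyC [x [e e_gt0 eP]] si0.
have Cx := interior_pt e_gt0 eP.
(* For constraints of side [s] this is [s] times the height of the graph of [f i]. *)
pose h i : affine R k := lincomb (0, 0) (`|lcoef (f i)|^-1) (restr (f i)).
have hE i y : eval (h i) y = `|lcoef (f i)|^-1 * eval (restr (f i)) y.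
  by rewrite eval_lincomb /eval dot0l /=; ring.
pose side := [seq i <- enum I | s * lcoef (f i) < 0].
have [u [x1 [e1 [us e1_gt0 sub1 uP]]]] := min_on_subbox h side i0 (proj x) e_gt0.
have sideP i : s * lcoef (f i) < 0 -> i \in i0 :: side.
  by move=> si; rewrite inE mem_filter si mem_enum orbT.
have su : s * lcoef (f u) < 0.
  by move: us; rewrite inE mem_filter => /orP [/eqP ->|/andP []].
have lu : lcoef (f u) != 0 by apply: contraTneq su => ->; rewrite mulr0 ltxx.
have s_norm i : s * lcoef (f i) < 0 -> lcoef (f i) = - s * `|lcoef (f i)|.
  move=> si; have -> : `|lcoef (f i)| = - (s * lcoef (f i)).
    rewrite -(ltr0_norm si) normrM.
    have -> : `|s| = 1 by apply/eqP; rewrite -(@eqrXn2 _ 2) // -normrX s2 normr1 expr1n.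
    by rewrite mul1r.
  have -> : - s * - (s * lcoef (f i)) = s ^+ 2 * lcoef (f i) by ring.
  by rewrite s2 mul1r.
exists (fun p => Defs.closure C p /\ eval (f u) p = 0).
have uE y : dot (- (lcoef (f u))^-1 *: (proj (f u).1)) y + - (lcoef (f u))^-1 * (f u).2
   = height (f u) y.
  by rewrite dotZl /height /eval /=; field.
exists (- (lcoef (f u))^-1 *: proj (f u).1), (- (lcoef (f u))^-1 * (f u).2).
split; [|split].
- move=> p /polyC /(_ u) /cmp0W; rewrite uE eval_split /height => fu.
  have -> : s * (- eval (restr (f u)) (proj p) / lcoef (f u)) =
    (s * lcoef (f u))^-1 * - eval (restr (f u)) (proj p).
    suff -> : (s * lcoef (f u))^-1 = s / lcoef (f u) by ring.
    have s0 : s != 0 by apply: contraTneq su => ->; rewrite mul0r ltxx.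
    by rewrite invfM; congr (_ * _); apply: (mulfI s0); rewrite mulfV // -s2 expr2.
  rewrite ler_ndivlMl //.
  have -> : s * lcoef (f u) * (s * lastc p) = s ^+ 2 * (lcoef (f u) * lastc p) by ring.
  by rewrite s2; lra.
- move=> p; rewrite uE; split=> -[clp fu]; split=> //.
    by rewrite (eval0_height lu fu) lastc_lift proj_lift.
  by rewrite -[p]lift_proj fu eval_height.
exists x1, e1 => // y yx1; exists (lift_pt y (height (f u) y)).
rewrite proj_lift eval_height //; split=> //; split=> //.
apply/(closure_polyhedron _ polyC Cx) => j.
have Cy : C (lift_pt y (lastc x)).
  apply: eP => i; rewrite -{2}[x]lift_proj !mxE; case: insubP => [a _ _|_].
    exact: sub1.
  by rewrite subrr normr0.
case: (ltP (s * lcoef (f j)) 0) => sj.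
  rewrite eval_on_height // eval_lincomb.
  have := uP j y (sideP j sj) yx1; rewrite !hE.
  have nj : 0 < `|lcoef (f j)| by rewrite normr_gt0; apply: contraTneq sj => ->; rewrite mulr0 ltxx.
  have nu : 0 < `|lcoef (f u)| by rewrite normr_gt0.
  move/(ler_wpM2l (ltW nj)); rewrite (mulVKf (lt0r_neq0 nj)) mulrA => le1.
  have s0 : s != 0 by apply: contraTneq su => ->; rewrite mul0r ltxx.
  have -> : lcoef (f j) / lcoef (f u) = `|lcoef (f j)| / `|lcoef (f u)|.
    rewrite [X in X / _](s_norm j sj) [X in _ / X](s_norm u su).
    by field; rewrite s0 lt0r_neq0.
  by move: le1; lra.
(* Going in direction [s] from height [lastc x] to the graph of [f u] does not decrease a constraint
   that is vertical or of the other side. *)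
have fj : 0 <= eval (f j) (lift_pt y (lastc x)) by move/polyC: Cy => /(_ j) /cmp0W.
have fu : 0 <= eval (f u) (lift_pt y (lastc x)) by move/polyC: Cy => /(_ u) /cmp0W.
rewrite eval_on_height //; move: fj; rewrite (eval_subst _ _ lu) proj_lift.
suff : lcoef (f j) / lcoef (f u) * eval (f u) (lift_pt y (lastc x)) <= 0 by lra.
rewrite mulr_le0_ge0 //.
have -> : lcoef (f j) / lcoef (f u) = (s * lcoef (f j)) / (s * lcoef (f u)).
  have s0 : s != 0 by apply: contraTneq su => ->; rewrite mul0r ltxx.
  by field; rewrite ?s0 ?lu.
by rewrite mulr_ge0_le0 // invr_le0 ltW.
Qed.

End LastCoordinate.

(** * Comparing constraints of the same side and of opposite sides *)

Section Substitution.
Variables (R : rcfType) (k : nat).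
Implicit Types (f g : affine R k.+1) (s : R).

Lemma side_neq0 s f : s * lcoef f < 0 -> lcoef f != 0.
Proof. by move=> sf; apply: contraTneq sf => ->; rewrite mulr0 ltxx. Qed.

Lemma subst_id f y : lcoef f != 0 -> eval (subst f f) y = 0.
Proof. by move=> f0; rewrite eval_lincomb divff //; ring. Qed.

Lemma subst_vert f g y : lcoef f = 0 -> eval (subst f g) y = eval (restr f) y.
Proof. by move=> f0; rewrite eval_lincomb f0; ring. Qed.

Lemma subst_swap f g y : lcoef f != 0 -> lcoef g != 0 ->
  eval (subst f g) y = - (lcoef f / lcoef g) * eval (subst g f) y.
Proof. by move=> f0 g0; rewrite !eval_lincomb; field; rewrite f0 g0. Qed.

Lemma same_side_ratio s f g : s * lcoef f < 0 -> s * lcoef g < 0 ->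
  0 < lcoef f / lcoef g.
Proof.
move=> sf sg; have s0 : s != 0 by apply: contraTneq sf => ->; rewrite mul0r ltxx.
have -> : lcoef f / lcoef g = (s * lcoef f) / (s * lcoef g).
  by field; rewrite s0 (side_neq0 sg).
by rewrite -mulrNN -invrN divr_gt0 ?oppr_gt0.
Qed.

(** [f] is its value on the graph of [g] plus a positive multiple of [g]. Hence the extreme
    constraint of a side implies the others of that side. *)
Lemma same_side s b f g p : s * lcoef f < 0 -> s * lcoef g < 0 ->
  0 <= eval (subst f g) (proj p) -> cmp0 b (eval g p) -> cmp0 b (eval f p).
Proof.
move=> sf sg fg; rewrite (eval_subst f p (side_neq0 sg)).
have r0 := same_side_ratio sf sg.
case: b => /= gp; first by rewrite ltr_wpDl // mulr_gt0.
by rewrite addr_ge0 // mulr_ge0 // ltW.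
Qed.

(** Both inequalities say that over [y] the lower graph [g = 0] is not above the upper graph
    [f = 0]. *)
Lemma opposite_side f g y : lcoef f < 0 -> 0 < lcoef g ->
  (0 <= eval (subst f g) y) = (0 <= eval (subst g f) y).
Proof.
move=> f0 g0; rewrite (subst_swap _ (ltr0_neq0 f0) (lt0r_neq0 g0)).
by rewrite pmulr_rge0 // -mulNr divr_gt0 ?oppr_gt0.
Qed.

End Substitution.

(** * Letters, and decoding a word into a prism *)

Section Letters.
Variable n : nat.

(* A letter is a set of at most two signed hyperplanes.  In [Some (i, j, b)]
   with [i != j] the sign of the smaller index is coded by the order of [i]
   and [j], so that there are only [2 n^2 + 1] letters. *)
Definition letter : Type := option ('I_n * 'I_n * bool).

Definition letter_labels (c : letter) : seq ('I_n * bool) :=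
  match c with
  | None => [::]
  | Some (i, j, b) =>
      if i == j then [:: (i, b)]
      else if (i < j)%N then [:: (i, true); (j, b)] else [:: (j, false); (i, b)]
  end.

Lemma letter_labels_lt (x y : 'I_n * bool) : (x.1 < y.1)%N ->
  exists c, letter_labels c = [:: x; y].
Proof.
case: x y => [i s] [j t] /= ij.
exists (Some (if s then (i, j, t) else (j, i, t))).
have nij : (i == j) = false by apply/negbTE; rewrite neq_ltn ij.
by case: s => /=; [rewrite nij ij | rewrite eq_sym nij ltnNge ltnW].
Qed.

Lemma letter_labels_pair (x y : 'I_n * bool) : x.1 != y.1 ->
  exists c, letter_labels c = [:: x; y] \/ letter_labels c = [:: y; x].
Proof.
by rewrite neq_ltn => /orP [] /letter_labels_lt [c <-]; exists c; auto.
Qed.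

Variables (R : rcfType) (k : nat).
Variable F : 'I_n -> bool -> affine R k.+1.

(** The sign of the last coefficient tells the ceiling from the floor, so a letter need not order
    its two labels. *)
Definition side_label (s : R) (c : letter) : option ('I_n * bool) :=
  ohead [seq x <- letter_labels c | s * lcoef (F x.1 x.2) < 0].

(** Ceiling and floor have coefficients of opposite sign, hence different indices; the diagonal
    letters serve when only one of them is present. *)
Lemma letter_exists (sg : 'I_n -> bool) (uo lo : option 'I_n) :
  (forall u, uo = Some u -> lcoef (F u (sg u)) < 0) ->
  (forall l, lo = Some l -> 0 < lcoef (F l (sg l))) ->
  exists c, side_label 1 c = omap (fun i => (i, sg i)) uo /\
            side_label (-1) c = omap (fun i => (i, sg i)) lo.
Proof.
rewrite /side_label; case: uo lo => [u|] [l|] /= hu hl.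
- have {}hu := hu u erefl; have {}hl := hl l erefl.
  have ul : (u, sg u).1 != (l, sg l).1.
    by apply: contraTneq hu => /= ->; rewrite -leNgt ltW.
  have [c cE] := letter_labels_pair ul; exists c.
  by case: cE => -> /=;
    rewrite !mul1r !mulN1r !oppr_lt0 hu hl !ltNge !ltW.
- have {}hu := hu u erefl; exists (Some (u, u, sg u)); rewrite /= eqxx /=.
  by rewrite mul1r mulN1r oppr_lt0 hu ltNge ltW.
- have {}hl := hl l erefl; exists (Some (l, l, sg l)); rewrite /= eqxx /=.
  by rewrite mul1r mulN1r oppr_lt0 hl ltNge ltW.
- by exists None.
Qed.

(* The constraints on the projection [P] of the part of the cell between the
   facets labelled [uo] and [lo].  An upper constraint only matters on the
   ceiling and a lower one only on the floor, so each hyperplane contributes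
   one constraint; the slot of the ceiling's own hyperplane records that the
   floor lies below the ceiling. *)
Definition next_constraints (uo lo : option ('I_n * bool)) (i : 'I_n) (s : bool) :
    affine R k :=
  let G x := F x.1 x.2 in
  match uo, lo with
  | Some u, Some l =>
      if i == u.1 then subst (G l) (G u)
      else subst (F i s) (if lcoef (F i s) < 0 then G u else G l)
  | Some u, None => subst (F i s) (G u)
  | None, Some l => subst (F i s) (G l)
  | None, None => restr (F i s)
  end.

End Letters.

(** The sign vector of the cell is not given: [F] offers both signs of every hyperplane and the
    letters select those that matter. After the first stage comparisons are weak, since projections
    of closed facets are described by weak inequalities. *)
Fixpoint decode (R : rcfType) n (k : nat) (b : bool) :
    ('I_n -> bool -> affine R k) -> seq (letter n) -> 'rV[R]_k -> Prop :=
  match k with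
  | 0 => fun _ _ _ => True
  | k'.+1 => fun F w p =>
      let uo := side_label F 1 (head None w) in
      let lo := side_label F (-1) (head None w) in
      oapp (fun u => cmp0 b (eval (F u.1 u.2) p)) true uo /\
      oapp (fun l => cmp0 b (eval (F l.1 l.2) p)) true lo /\
      decode false (next_constraints F uo lo) (behead w) (proj p)
  end.

(** * One stage of the decomposition *)

Section Step.
Variables (R : rcfType) (k : nat) (I : finType).
Variables (b : bool) (f : I -> affine R k.+1) (C : 'rV[R]_k.+1 -> Prop).

Definition facet_spec (s : R) (o : option I) (Fc : 'rV[R]_k.+1 -> Prop) : Prop :=
  match o with
  | Some u => s * lcoef (f u) < 0 /\
      forall p, Fc p <-> (forall j, 0 <= eval (f j) p) /\ eval (f u) p = 0
  | None => (forall j, 0 <= s * lcoef (f j)) /\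
      forall p, Fc p <-> forall j, 0 <= eval (f j) p
  end.

Lemma side_spec_exists s Fc : s ^+ 2 = 1 -> polyhedron b f C -> has_interior C ->
  side_facet s C Fc \/
    ((~ exists g, side_facet s C g) /\ forall p, Fc p <-> Defs.closure C p) ->
  exists o, facet_spec s o Fc.
Proof.
move=> s2 polyC intC; have [x [e e0 eP]] := intC.
have Cx := interior_pt e0 eP.
case=> [sfc|[noF FP]].
  by have [u su uP] := side_facet_label s2 polyC Cx sfc; exists (Some u).
exists None; split=> [j|p]; last by rewrite FP; apply: closure_polyhedron polyC Cx.
by rewrite leNgt; apply/negP => sj; apply: noF; apply: side_facet_exists sj.
Qed.

(** A pointwise form of [facet_spec]: [u] is extreme over the single point [y]. It also makes sense
    in dimension one, where [vd] chooses no facets. *)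
Definition tight (s : R) (o : option I) (y : 'rV[R]_k) : Prop :=
  match o with
  | Some u => s * lcoef (f u) < 0 /\
      forall j, s * lcoef (f j) < 0 -> 0 <= eval (subst (f j) (f u)) y
  | None => forall j, 0 <= s * lcoef (f j)
  end.

Lemma projS_facet s u Fc y : facet_spec s (Some u) Fc ->
  projS Fc y <-> forall j, 0 <= eval (subst (f j) (f u)) y.
Proof.
move=> [su FP]; have lu := side_neq0 su; split=> [[p [/FP [p0 pu] <-] j]|H].
  by have := p0 j; rewrite (eval0_height lu pu) eval_on_height // proj_lift.
exists (lift_pt y (height (f u) y)); rewrite proj_lift; split=> //; apply/FP.
by rewrite eval_height //; split=> // j; rewrite eval_on_height.
Qed.

Lemma projS_tight s o Fc y : facet_spec s o Fc -> projS Fc y -> tight s o y.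
Proof.
case: o => [u|] spec; last by case: spec.
by move=> /(projS_facet _ spec) H; split=> [|j _]; [case: spec | exact: H].
Qed.

Lemma projS_vertical s o Fc y j : facet_spec s o Fc -> projS Fc y ->
  lcoef (f j) = 0 -> 0 <= eval (restr (f j)) y.
Proof.
move=> spec [p [Fp <-]] lj.
have : 0 <= eval (f j) p.
  by case: o spec => [u|] [_ FP]; move/FP: Fp => // -[].
by rewrite eval_split lj mul0r addr0.
Qed.

(** By [same_side] the extreme constraint of each side implies the rest of that side. Vertical
    constraints follow from neither label and are assumed. *)
Lemma between_labels uo lo p :
  tight 1 uo (proj p) -> tight (-1) lo (proj p) ->
  (forall j, lcoef (f j) = 0 -> cmp0 b (eval (f j) p)) ->
  (forall j, cmp0 b (eval (f j) p)) <->
    oapp (fun u => cmp0 b (eval (f u) p)) true uo /\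
    oapp (fun l => cmp0 b (eval (f l) p)) true lo.
Proof.
move=> tu tl vert; split=> [H|[Hu Hl] j].
  by case: uo {tu} => [u|]; case: lo {tl} => [l|] /=.
case: (ltgtP (lcoef (f j)) 0) => [lj|lj|/vert //].
  case: uo tu Hu => [u|] /=; last by move=> /(_ j); rewrite mul1r leNgt lj.
  move=> [su H] Hu; have lj1 : 1 * lcoef (f j) < 0 by rewrite mul1r.
  exact: same_side lj1 su (H j lj1) Hu.
case: lo tl Hl => [u|] /=; last by move=> /(_ j); rewrite mulN1r oppr_ge0 leNgt lj.
move=> [su H] Hl; have lj1 : -1 * lcoef (f j) < 0 by rewrite mulN1r oppr_lt0.
exact: same_side lj1 su (H j lj1) Hl.
Qed.

End Step.

Lemma tight_exists (R : rcfType) (I : finType) (f : I -> affine R 1) s (y : 'rV[R]_0) :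
  s ^+ 2 = 1 -> exists o, tight f s o y.
Proof.
move=> s2.
case: (boolP [exists i, s * lcoef (f i) < 0]); last first.
  by rewrite negb_exists => /forallP H; exists None => j; rewrite leNgt.
move=> /existsP [i0 si0].
(* As [s ^+ 2 = 1], this is [s] times the height at which [f i] vanishes over [y]; its minimizer is
   the end of the interval on side [s]. *)
pose h i := - (eval (restr (f i)) y / (s * lcoef (f i))).
case: (@arg_minP _ _ _ i0 (fun i => s * lcoef (f i) < 0) h si0) => u su uP.
exists (Some u); split=> // j sj; have := uP j sj; rewrite /h eval_lincomb.
have s0 : s != 0 by apply: contraTneq su => ->; rewrite mul0r ltxx.
rewrite lerN2 ler_ndivrMr // => le1.
have -> : lcoef (f j) / lcoef (f u) = (s * lcoef (f j)) / (s * lcoef (f u)).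
  by field; rewrite s0 (side_neq0 su).
by move: le1; rewrite mulrAC mulNr; lra.
Qed.

(** * Every prism of a polyhedron is decoded from a word *)

Section Coding.
Variables (R : rcfType) (n : nat).

Lemma vd_sub k (C S : 'rV[R]_k -> Prop) p : vd C S -> S p -> C p.
Proof.
case: k C S p => [|k] C S p /=; first by move=> H /H.
rewrite /vd_step; case: eqP => _; first by move=> H /H.
by move=> [Fu [Fl [_ [_ [_ [Q [_ H]]]]]]] /H [].
Qed.

(* An open cell, unlike the closed projections, does not contain the vertical
   part of its boundary, so the letters only determine its prisms if no
   constraint is vertical. *)
Definition generic_family k (b : bool) (f : 'I_n -> affine R k) : Prop :=
  b -> forall i, (forall m, (f i).1 0 m != 0) \/ (f i).1 = 0.

(** The projection of a facet is cut out by all constraints substituted on its graph. Once the floor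
    is known to lie below the ceiling, the lower constraints on the ceiling and the upper ones on
    the floor are implied by the kept ones. *)
Lemma next_constraintsP k (F : 'I_n -> bool -> affine R k.+1) (sg : 'I_n -> bool)
    uo lo Fu Fl y :
  let f i := F i (sg i) in let lab := omap (fun i => (i, sg i)) in
  facet_spec f 1 uo Fu -> facet_spec f (-1) lo Fl ->
  (projS Fu y /\ projS Fl y) <->
  forall j, cmp0 false (eval (next_constraints F (lab uo) (lab lo) j (sg j)) y).
Proof.
move=> f lab; case: uo lo => [u|] [l|] su sl.
- rewrite (projS_facet _ su) (projS_facet _ sl) /next_constraints /=.
  have {su} [su _] := su; have {sl} [sl _] := sl.
  move: su sl; rewrite mul1r mulN1r oppr_lt0 => lu ll.
  have u0 := ltr0_neq0 lu; have l0 := lt0r_neq0 ll.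
  split=> [[Hu Hl] j|H].
    case: eqP => [_|_]; first exact: Hu.
    by case: ifP => _; [exact: Hu | exact: Hl].
  have lu_ge0 : 0 <= eval (subst (f l) (f u)) y by have := H u; rewrite eqxx.
  have Hup j : lcoef (f j) < 0 -> 0 <= eval (subst (f j) (f u)) y.
    move=> lj; have := H j; case: eqP => [-> _|_]; first by rewrite subst_id.
    by rewrite /f in lj *; rewrite lj.
  have Hlo j : 0 <= lcoef (f j) -> 0 <= eval (subst (f j) (f l)) y.
    move=> lj; have := H j; case: eqP => [ju|_]; first by move: lj; rewrite ju leNgt lu.
    by rewrite /f in lj *; rewrite ltNge lj.
  (* The ceiling is above the floor, and the floor is above the lower graph of [f j]; [mixl] is the
     mirror image. *)
  have mixu j : 0 < lcoef (f j) -> 0 <= eval (subst (f j) (f u)) y.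
    move=> lj; rewrite -eval_on_height //.
    apply: (@same_side _ _ (-1) false _ (f l)); rewrite ?mulN1r ?oppr_lt0 ?proj_lift //=.
      exact/Hlo/ltW.
    by rewrite eval_on_height.
  have mixl j : lcoef (f j) < 0 -> 0 <= eval (subst (f j) (f l)) y.
    move=> lj; rewrite -eval_on_height //.
    apply: (@same_side _ _ 1 false _ (f u)); rewrite ?mul1r ?proj_lift //=.
      exact: Hup.
    by rewrite eval_on_height // opposite_side.
  split=> j; case: (ltgtP (lcoef (f j)) 0) => lj.
  + exact: Hup.
  + exact: mixu.
  + by rewrite subst_vert // -(subst_vert (f l) _ lj) Hlo // lj.
  + exact: mixl.
  + exact/Hlo/ltW.
  + by rewrite Hlo // lj.
- rewrite (projS_facet _ su) /=; split=> [[]//|H]; split=> //.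
  (* Without a floor, [Fl] is the closed polyhedron, so the point of the ceiling over [y] also
     witnesses the projection of [Fl]. *)
  have [lu _] := su; have [_ FP] := sl.
  exists (lift_pt y (height (f u) y)); rewrite proj_lift; split=> //; apply/FP => j.
  by rewrite (eval_on_height _ _ (side_neq0 lu)); apply: H.
- rewrite (projS_facet _ sl) /=; split=> [[]//|H]; split=> //.
  have [lu _] := sl; have [_ FP] := su.
  exists (lift_pt y (height (f l) y)); rewrite proj_lift; split=> //; apply/FP => j.
  by rewrite (eval_on_height _ _ (side_neq0 lu)); apply: H.
- have [nu FPu] := su; have [nl FPl] := sl.
  have vert j : lcoef (f j) = 0.
    by apply/eqP; rewrite eq_le; have := nu j; have := nl j; rewrite mul1r mulN1r oppr_ge0 => -> ->.
  (* With neither facet all constraints are vertical, so any lift of [y] will do; height [0] is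
     used. *)
  split=> [[Pu _] j|H] /=; first exact: (projS_vertical su Pu (vert j)).
  have Hp j : 0 <= eval (f j) (lift_pt y 0).
    by rewrite eval_lift vert mul0r addr0; apply: H.
  by split; exists (lift_pt y 0); rewrite proj_lift ?FPu ?FPl.
Qed.

(** Induction on the dimension. The projected region is again a polyhedron of a signed family with
    the same signs [sg], which is why [F] and [b] are generalized. *)
Lemma vd_decode k b (F : 'I_n -> bool -> affine R k) (sg : 'I_n -> bool) C S :
  let f i := F i (sg i) in
  generic_family b f -> polyhedron b f C -> has_interior C -> vd C S ->
  exists2 w : seq (letter n), size w = k & forall p, S p <-> decode b F w p.
Proof.
elim: k b F C S => [|k IHk] b F C S f genf polyC intC vdS.
  exists [::] => // p; rewrite vdS; split=> // _.
  have [x [e e0 eP]] := intC; have := interior_pt e0 eP.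
  by congr C; apply/rowP => -[].
have [x [e e0 eP]] := intC; have Cx := interior_pt e0 eP.
(* In an open cell genericity makes a vertical constraint constant, so it holds everywhere because
   it holds at [x]. *)
have vertb p j : b -> lcoef (f j) = 0 -> cmp0 b (eval (f j) p).
  move=> bT lj; have [nz|f1] := genf bT j; first by case/eqP: (nz ord_max); exact: lj.
  by rewrite (eval_const p x f1); move/polyC: Cx; apply.
move: vdS; rewrite /= /vd_step; case: eqP => [k0|_] vdS.
  subst k.
  have [uo tu] := tight_exists f (proj x) (expr1n R 2).
  have [lo tl] := tight_exists f (proj x) (sqrr_sign R 1).
  rewrite expr1 in tl.
  have [||c [cu cl]] := @letter_exists n R 0 F sg uo lo.
  - by move=> u uoE; move: tu; rewrite uoE /= mul1r => -[].
  - by move=> u uoE; move: tl; rewrite uoE /= mulN1r oppr_lt0 => -[].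
  exists [:: c] => // p; rewrite vdS polyC /= cu cl.
  have px : proj p = proj x by apply/rowP => -[].
  have := @between_labels _ _ _ b f uo lo p; rewrite px => /(_ tu tl) => ->.
    by case: (uo) => [u|]; case: (lo) => [l|] /=; tauto.
  move=> j lj; rewrite eval_split px lj mul0r -(mul0r (lastc x)) -lj -eval_split.
  by move/polyC: Cx; apply.
have [Fu [Fl [cei [flo [intP [Q [vdQ SP]]]]]]] := vdS.
have [uo su] : exists o, facet_spec f 1 o Fu.
  apply: (side_spec_exists (expr1n R 2) polyC intC).
  case: cei => [/upper_facetE|[no ?]]; [by left | right; split=> //].
  by move=> [g /upper_facetE gP]; apply: no; exists g.
have [lo sl] : exists o, facet_spec f (-1) o Fl.
  apply: (side_spec_exists (sqrr_sign R 1) polyC intC).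
  case: flo => [/lower_facetE|[no ?]]; [by left | right; split=> //].
  by move=> [g /lower_facetE gP]; apply: no; exists g.
have [||c [cu cl]] := @letter_exists n R k F sg uo lo.
- by move=> u uoE; move: su; rewrite uoE /= mul1r => -[].
- by move=> u uoE; move: sl; rewrite uoE /= mulN1r oppr_lt0 => -[].
have polyP := fun y => next_constraintsP y su sl.
(* The flag is now [false], which makes [generic_family] vacuous. *)
have [//|w sw QP] := IHk false _ _ _ _ polyP intP vdQ.
exists (c :: w); first by rewrite /= sw.
move=> p; rewrite SP polyC /= cu cl -QP.
suff H : Q (proj p) -> (forall j, cmp0 b (eval (f j) p)) <->
    oapp (fun u => cmp0 b (eval (f u) p)) true uo /\
    oapp (fun l => cmp0 b (eval (f l) p)) true lo.
  by case: (uo) (lo) H => [u|] [l|] /=; tauto.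
move=> /(vd_sub vdQ) [Pu Pl].
apply: between_labels; [exact: projS_tight su Pu | exact: projS_tight sl Pl |].
move=> j lj; case: (boolP b) (vertb p j) => [bT|bF] H; first by apply: H.
by rewrite /= eval_split lj mul0r addr0; apply: projS_vertical su Pu lj.
Qed.

End Coding.

(** * Cells inside flats, read in the coordinates of a frame *)

Section Flats.
Variables (R : rcfType) (d n : nat) (a : 'I_n -> 'rV[R]_d) (b : 'I_n -> R).

Definition affine_map j (phi : 'rV[R]_j -> 'rV[R]_d) : Prop :=
  forall y, phi y = phi 0 + \sum_(k < j) y 0 k *: (phi (unitv R k) - phi 0).

Lemma sum_unitv j (w : 'I_j -> 'rV[R]_d) k :
  \sum_(l < j) unitv R k 0 l *: w l = w k.
Proof.
rewrite (bigD1 k) //= big1 => [|i /negPf ik]; first by rewrite mxE eqxx scale1r addr0.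
by rewrite mxE ik scale0r.
Qed.

Lemma is_frame_affine j (phi : 'rV[R]_j -> 'rV[R]_d) G : is_frame phi G -> affine_map phi.
Proof.
move=> [p0 [v [phiE _]]] y.
have phi0 : phi 0 = p0.
  by rewrite phiE big1 ?addr0 // => i _; rewrite mxE scale0r.
rewrite {1}phiE phi0; congr (_ + _); apply: eq_bigr => k _.
by rewrite phiE sum_unitv addrAC subrr add0r.
Qed.

Lemma id_affine : affine_map (fun y : 'rV[R]_d => y).
Proof.
move=> y; rewrite add0r [LHS]row_sum_delta; apply: eq_bigr => k _.
by congr (_ *: _); apply/rowP => i; rewrite subr0 !mxE.
Qed.

Definition pullback j (phi : 'rV[R]_j -> 'rV[R]_d) i : affine R j :=
  (\row_k dot (a i) (phi (unitv R k) - phi 0), dot (a i) (phi 0) - b i).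

Lemma dot_sumr (I : finType) (u : 'rV[R]_d) (w : I -> 'rV[R]_d) :
  dot u (\sum_i w i) = \sum_i dot u (w i).
Proof.
by rewrite dotE linear_sum mulmx_sumr summxE; apply: eq_bigr => i _; rewrite dotE.
Qed.

Lemma eval_pullback j (phi : 'rV[R]_j -> 'rV[R]_d) i y : affine_map phi ->
  eval (pullback phi i) y = dot (a i) (phi y) - b i.
Proof.
move=> phiE; rewrite (phiE y) dotDr dot_sumr /eval /pullback /=.
rewrite [X in X + _ = _](_ : _ =
  \sum_k dot (a i) (y 0 k *: (phi (unitv R k) - phi 0))); first by ring.
by apply: eq_bigr => k _; rewrite dotZr mxE mulrC.
Qed.

(* The constant [1] stands for the hyperplanes through the flat, which must not
   cut its cells. *)
Definition flat_constraints j (Z : {set 'I_n}) (phi : 'rV[R]_j -> 'rV[R]_d)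
    (i : 'I_n) (s : bool) : affine R j :=
  if i \in Z then (0, 1)
  else lincomb (0, 0) (if s then 1 else -1) (pullback phi i).

Lemma eval_flat_constraints j Z (phi : 'rV[R]_j -> 'rV[R]_d) i s y : affine_map phi ->
  eval (flat_constraints Z phi i s) y =
  if i \in Z then 1 else (if s then 1 else -1) * (dot (a i) (phi y) - b i).
Proof.
move=> phiE; rewrite /flat_constraints; case: ifP => _.
  by rewrite /eval dot0l add0r.
by rewrite eval_lincomb eval_pullback // /eval dot0l !add0r.
Qed.

Definition side_of (x : 'rV[R]_d) (i : 'I_n) : bool := 0 < dot (a i) x - b i.

Lemma cell_polyhedron j (phi : 'rV[R]_j -> 'rV[R]_d) x : affine_map phi ->
  (forall y, flatZ a b (zset a b x) (phi y)) ->
  polyhedron true (fun i => flat_constraints (zset a b x) phi i (side_of x i))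
    (fun y => cell_of a b x (phi y)).
Proof.
move=> phiE phiZ y; split=> H i; have := H i;
  rewrite eval_flat_constraints // /side_of /=.
- case: ifP => [_ _|iZ]; first exact: ltr01.
  have xi : dot (a i) x - b i != 0 by rewrite subr_eq0; move: iZ; rewrite inE => ->.
  case: (ltgtP 0 (dot (a i) x - b i)) xi => [xi|xi|//].
  + by rewrite (gtr0_sg xi) mul1r => _ /eqP; rewrite sgr_cp0.
  + by rewrite (ltr0_sg xi) mulN1r oppr_gt0 => _ /eqP; rewrite sgr_cp0.
- case: ifP => [iZ _|iZ].
    have /eqP xi : dot (a i) x == b i by move: iZ; rewrite inE.
    by have := phiZ y i iZ; rewrite /hyp => ->; rewrite xi.
  have xi : dot (a i) x - b i != 0 by rewrite subr_eq0; move: iZ; rewrite inE => ->.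
  case: (ltgtP 0 (dot (a i) x - b i)) xi => [xi|xi|//].
  + by rewrite mul1r (gtr0_sg xi) => _ yi; apply: gtr0_sg.
  + by rewrite mulN1r oppr_gt0 (ltr0_sg xi) => _ yi; apply: ltr0_sg.
Qed.

(** A nonconstant pullback with a zero coefficient would vanish on a line parallel to that axis,
    against the genericity of the frame for the singleton [[set i]]. *)
Lemma cell_generic j Z (phi : 'rV[R]_j -> 'rV[R]_d) (s : 'I_n -> bool) :
  affine_map phi -> frame_generic a b Z phi ->
  generic_family true (fun i => flat_constraints Z phi i (s i)).
Proof.
have linE c (g : affine R j) : (lincomb (0, 0) c g).1 = c *: g.1 by rewrite /= add0r.
move=> phiE gen _ i; rewrite /flat_constraints; case: ifP => [|iZ]; first by right.
have [g1|gn0] := eqVneq (pullback phi i).1 0.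
  by right; rewrite linE g1 scaler0.
left=> m; rewrite linE mxE mulf_neq0 //; first by case: (s i); rewrite ?oppr_eq0 oner_eq0.
have S0 : [set i] != set0 by apply/set0Pn; exists i; rewrite inE.
have SZ : [set i] \subset ~: Z by rewrite sub1set inE iZ.
apply/negP => /eqP gm; apply: (gen _ S0 SZ m).
have /rV0Pn [k gk] := gn0.
(* The zero of the pullback on axis [k], where its coefficient is nonzero. *)
exists (- ((pullback phi i).2 / (pullback phi i).1 0 k) *: unitv R k) => t i'.
rewrite inE => /eqP ->; apply/eqP; rewrite /hyp -subr_eq0 -eval_pullback //.
rewrite /eval dotDr !dotZr !dot_unitv.
by rewrite gm mulr0 addr0 mulNr divfK // addNr.
Qed.

Lemma cell_word j (phi : 'rV[R]_j -> 'rV[R]_d) x C S : affine_map phi ->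
  (forall y, flatZ a b (zset a b x) (phi y)) -> (exists y, phi y = x) ->
  frame_generic a b (zset a b x) phi ->
  (forall y, C y <-> cell_of a b x (phi y)) -> vd C S ->
  exists2 w : seq (letter n), size w = j &
    forall p, S p <-> decode true (flat_constraints (zset a b x) phi) w p.
Proof.
move=> phiE phiZ [yx phix] gen CE vdS.
have Cpoly : polyhedron true
    (fun i => flat_constraints (zset a b x) phi i (side_of x i)) C.
  by move=> y; rewrite CE; apply: cell_polyhedron.
apply: (vd_decode (cell_generic _ phiE gen) Cpoly _ vdS).
have /Cpoly Cx : C yx by apply/CE; rewrite phix.
by have [e e0 eP] := evals_pos_near Cx; exists yx, e => // y /eP /Cpoly.
Qed.

(** The directions of the flat form the kernel of the normals of [Z], so these normals have rank
    [d - j], and a maximal independent subfamily cuts out the flat. The size of [B] is what gives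
    all words length [d]. *)
Lemma frame_basis j (phi : 'rV[R]_j -> 'rV[R]_d) x : let Z := zset a b x in
  is_frame phi (flatZ a b Z) ->
  exists B : seq 'I_n, (size B + j = d)%N /\
    forall y, flatZ a b Z y <-> forall i, i \in B -> hyp a b i y.
Proof.
move=> Z [p0 [v [phiE [v_free v_span]]]].
(* Zero rows outside [Z] keep the index type ['I_n]; an independent choice of rows avoids them. *)
pose A : 'M[R]_(n, d) := \matrix_i (if i \in Z then a i else 0).
have Zx : flatZ a b Z x by move=> i; rewrite inE => /eqP.
have AP (w : 'rV[R]_d) : w *m A^T = 0 <-> forall i, i \in Z -> dot (a i) w = 0.
  split=> [/rowP H i iZ|H]; last first.
    apply/rowP => i; rewrite [RHS]mxE.
    have := H i; rewrite /dot => Hi; rewrite mxE.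
    case: (boolP (i \in Z)) Hi => iZ Hi.
      by rewrite -[RHS]Hi //; apply: eq_bigr => k _; rewrite !mxE iZ mulrC.
    by rewrite big1 // => k _; rewrite !mxE (negPf iZ) mxE mulr0.
  have := H i; rewrite [in RHS]mxE => <-; rewrite mxE /dot.
  by apply: eq_bigr => k _; rewrite !mxE iZ mulrC.
have flatE y : flatZ a b Z y <-> (y - x) *m A^T = 0.
  rewrite AP; split=> H i iZ; first by rewrite dotBr (H i iZ) (Zx i iZ) subrr.
  by apply/eqP; rewrite -subr_eq0 -(Zx i iZ) -dotBr H.
pose V : 'M[R]_(j, d) := \matrix_k v k.
have VE (y : 'rV[R]_j) : y *m V = \sum_(k < j) y 0 k *: v k.
  by rewrite mulmx_sum_row; apply: eq_bigr => k _; rewrite rowK.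
have V_free : row_free V by apply: inj_row_free => y; rewrite VE; apply: v_free.
have [yx phix] : exists y, phi y = x by apply/v_span.
have V_ker : (V :=: kermx A^T)%MS.
  apply/eqmxP/andP; split; apply/row_subP => i.
    apply/sub_kermxP; rewrite rowK.
    have /flatE : flatZ a b Z (phi (yx + unitv R i)) by apply/v_span; exists (yx + unitv R i).
    have -> // : phi (yx + unitv R i) - x = v i.
    rewrite -[X in _ - X]phix !phiE -!VE mulmxDl [X in _ + (_ + X)]VE sum_unitv.
    by rewrite addrA [_ + v i]addrC addrK.
  have /flatE/v_span [y phiy] : (row i (kermx A^T) + x - x) *m A^T = 0.
    by rewrite addrK; apply/sub_kermxP/row_sub.
  have -> : row i (kermx A^T) = (y - yx) *m V.
    move: phiy; rewrite -[X in _ = _ + X]phix !phiE -!VE mulmxBl.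
    by move/eqP; rewrite -subr_eq => /eqP <-; rewrite opprD addrACA subrr add0r.
  exact: submxMl.
have rank_j : (\rank A + j = d)%N.
  have := mxrank_ker A^T; rewrite -V_ker (eqP V_free) mxrank_tr => ->.
  by rewrite subnKC // rank_leq_col.
pose f := maxrankfun A.
have fZ i : f i \in Z.
  apply/negPn/negP => fi.
  have : delta_mx 0 i *m rowsub f A = 0 :> 'rV_d.
    by rewrite -rowE; apply/rowP => k; rewrite !mxE (negPf fi) mxE.
  move/eqP; rewrite (mulmx_free_eq0 _ (maxrowsub_free A)) => /eqP/rowP/(_ i).
  by rewrite !mxE !eqxx => /eqP; rewrite oner_eq0.
exists [seq f i | i <- enum 'I_(\rank A)]; split; first by rewrite size_map size_enum_ord.
move=> y; split=> [H i /mapP [k _ ->]|H]; first exact/H/fZ.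
apply/flatE; have /submxP [D AD] : (A <= rowsub f A)%MS by rewrite eq_maxrowsub.
rewrite AD trmx_mul mulmxA; suff -> : (y - x) *m (rowsub f A)^T = 0 by rewrite mul0mx.
apply/rowP => k; rewrite [RHS]mxE.
have : dot (a (f k)) (y - x) = 0.
  rewrite dotBr (Zx _ (fZ k)); apply/eqP; rewrite subr_eq0; apply/eqP; apply: H.
  by apply: map_f; rewrite mem_enum.
by move=> <-; rewrite mxE; apply: eq_bigr => l _; rewrite !mxE fZ mulrC.
Qed.

(** * Words of length [d] for the prisms of the arrangement *)

Section Words.
Variable fr : forall j : nat, {set 'I_n} -> 'rV[R]_j -> 'rV[R]_d.
Hypothesis gen : generic a b.
Hypothesis frames : good_frames a b fr.

(* For the empty zero set (a full-dimensional cell) only [j = d] occurs, and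
   there [conform_mx 0] is the identity. *)
Definition frame_of j (Z : {set 'I_n}) (y : 'rV[R]_j) : 'rV[R]_d :=
  if Z == set0 then conform_mx 0 y else fr Z y.

(* A prism of a cell in a flat of codimension [c] is coded by [c] hyperplanes
   cutting out the flat, followed by the [d - c] letters of the prism. *)
Definition prism_word (S : 'rV[R]_d -> Prop) (W : seq ('I_n + letter n)) : Prop :=
  exists x (B : seq 'I_n) (w : seq (letter n)), let Z := zset a b x in
  [/\ W = map inl B ++ map inr w,
      forall y, flatZ a b Z y <-> forall i, i \in B -> hyp a b i y
    & forall p, S p <-> exists y : 'rV[R]_(size w),
        decode true (flat_constraints Z (@frame_of (size w) Z)) w y /\ frame_of Z y = p].

Lemma prism_word_exists S : VD_prism a b fr S ->
  exists2 W, size W = d & prism_word S W.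
Proof.
move=> [x [[Z0 vdS]|[Zn0 [j [isfr [Q [vdQ SP]]]]]]].
- pose phi := @frame_of d (zset a b x).
  have phiE y : phi y = y by rewrite /phi /frame_of Z0 eqxx conform_mx_id.
  have phiA : affine_map phi by
    move=> y; rewrite !phiE [LHS](id_affine y); congr (_ + _); apply: eq_bigr => k _; rewrite phiE.
  have gen0 : frame_generic a b (zset a b x) phi.
    move=> S' S0 _ m [y yP]; apply: (gen S0 (m := m)); exists y => t i iS.
    by rewrite -[_ + _]phiE; apply: yP.
  have [|||w sw wP] := @cell_word d phi x (cell_of a b x) S phiA _ _ gen0 _ vdS.
  + by move=> y i; rewrite Z0 inE.
  + by exists x.
  + by move=> y; rewrite phiE.
  exists (map inl [::] ++ map inr w); first by rewrite size_map.
  exists x, [::], w; split=> //; first by move=> y; rewrite Z0; split=> // _ i; rewrite inE.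
  rewrite sw => p; rewrite wP; split=> [H|[y [H <-]]]; first by exists p; split; last exact: phiE.
  by rewrite -/(phi y) phiE.
have [isfr' genZ] := frames Zn0 (ex_intro (fun phi : _ -> _ => is_frame phi _) _ isfr).
have [B [sB BP]] := frame_basis isfr.
have [w sw wP] : exists2 w : seq (letter n), size w = j &
    forall p, Q p <-> decode true (flat_constraints (zset a b x) (fr (zset a b x))) w p.
  have [_ [_ [_ [_ isf]]]] := isfr.
  apply: (cell_word (x := x)) (is_frame_affine isfr) _ _ genZ _ vdQ => //.
    by move=> y; apply/isf; exists y.
  by apply/isf => i; rewrite inE => /eqP.
exists (map inl B ++ map inr w); first by rewrite size_cat !size_map sw.
exists x, B, w; split=> // p.
(* An equality of functions, because [decode] receives the frame unapplied. *)
have fE k : @frame_of k (zset a b x) =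
    if zset a b x == set0 then fun y => conform_mx 0 y else @fr k (zset a b x).
  by rewrite /frame_of; case: ifP.
rewrite fE (negPf Zn0) sw SP.
by split=> -[y [H <-]]; exists y; split=> //; apply/wP.
Qed.

Lemma word_inj (B B' : seq 'I_n) (w w' : seq (letter n)) :
  map inl B ++ map inr w = map inl B' ++ map inr w' :> seq ('I_n + letter n) ->
  B = B' /\ w = w'.
Proof.
elim: B B' => [|i B IH] [|i' B'] /=.
- elim: w w' => [|c w IH] [|c' w'] //= [-> /IH [_ ->]] //.
- by case: w.
- by case: (w').
- by case=> -> /IH [-> ->].
Qed.

(** The hyperplanes of the word determine the flat. The flat determines the zero set, since each [x]
    lies in its own flat, and the zero set fixes the frame and the constraints to decode with. *)
Lemma prism_word_fun S S' W : prism_word S W -> prism_word S' W ->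
  forall p, S p <-> S' p.
Proof.
move=> [x [B [w [-> BP SP]]]] [x' [B' [w' [/word_inj [eB ew] BP' SP']]]].
subst B' w'.
have Zsub x1 x2 : (forall y, flatZ a b (zset a b x1) y <-> flatZ a b (zset a b x2) y) ->
    zset a b x1 \subset zset a b x2.
  move=> H; apply/subsetP => i i1.
  have /H/(_ i i1) : flatZ a b (zset a b x2) x2 by move=> k; rewrite inE => /eqP.
  by rewrite /hyp inE => ->.
have eZ : zset a b x = zset a b x'.
  by apply/eqP; rewrite eqEsubset !Zsub // => y; rewrite BP BP'.
by move=> p; rewrite SP SP' eZ.
Qed.

Lemma card_prisms m (P : 'I_m -> 'rV[R]_d -> Prop) :
  (forall k, VD_prism a b fr (P k)) ->
  (forall k l, k != l -> ~ (forall p, P k p <-> P l p)) ->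
  (m <= (n + (n * n * 2).+1) ^ d)%N.
Proof.
move=> prP distinct.
have /fin_all_exists [W WP] k : exists W : d.-tuple ('I_n + option ('I_n * 'I_n * bool)),
    prism_word (P k) W.
  have [W sW WP] := prism_word_exists (prP k).
  by exists (Tuple (introT eqP sW)).
have W_inj : injective W.
  move=> k l kl; apply/eqP/negPn/negP => /distinct; apply.
  by apply: prism_word_fun (WP k) _; rewrite kl.
have := leq_card W W_inj.
by rewrite card_ord card_tuple card_sum card_option !card_prod !card_ord card_bool.
Qed.

End Words.
End Flats.

(** * Numerical estimates and the final bound *)

(** This is [(1 + 1/n)^k <= 1 / (1 - k/n)] without denominators; the induction rests on
    [(n + 1) (n - k - 1) <= n (n - k)]. *)
Lemma succ_expn_le n k : (k <= n)%N -> (n.+1 ^ k * (n - k) <= n ^ k.+1)%N.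
Proof.
elim: k => [|k IH] kn; first by rewrite subn0 expn0 expn1 mul1n.
rewrite expnSr -mulnA [leqRHS]expnSr.
apply: leq_trans (leq_mul (IH (ltnW kn)) (leqnn n)).
by rewrite -mulnA leq_mul2l; apply/orP; right; nia.
Qed.

(** The ratio [d^4 / 2^d] peaks at [d = 6] with value 20.25; from there on a step less than doubles
    [d^4]. *)
Lemma pow4_le d : (d ^ 4 <= 21 * 2 ^ d)%N.
Proof.
elim: d => [|d IH] //.
have [d5|d6] := leqP d 5.
  by move: d d5 {IH}; do 6?case=> //.
rewrite [(2 ^ d.+1)%N]expnS mulnCA; apply: leq_trans (_ : 2 * d ^ 4 <= _)%N;
  last by rewrite leq_mul2l IH.
by rewrite !expnS !expn0; nia.
Qed.

(** The base is at most [2 n (n + 1)], and [(n + 1)^d <= n^(d+1) / (n - d) <= 2 n^d] because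
    [n >= 2d]. *)
Lemma words_le d n : (1 <= d)%N -> (2 * d <= n)%N ->
  ((n + (n * n * 2).+1) ^ d <= 2 * 2 ^ d * n ^ (2 * d))%N.
Proof.
move=> d1 dn.
have base : (n + (n * n * 2).+1 <= 2 * n * n.+1)%N by nia.
have -> : (2 * 2 ^ d * n ^ (2 * d) = 2 ^ d * n ^ d * (2 * n ^ d))%N.
  by rewrite mulnC mul2n -addnn expnD; ring.
apply: leq_trans (_ : (2 * n * n.+1) ^ d <= _)%N; first by rewrite leq_exp2r.
rewrite !expnMn leq_mul2l; apply/orP; right.
have n_gt0 : (0 < n)%N by lia.
have := @succ_expn_le n d ltac:(lia); rewrite expnS => le1.
rewrite -(@leq_pmul2l n) //.
apply: leq_trans (_ : 2 * (n.+1 ^ d * (n - d)) <= _)%N; last first.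
  by rewrite [leqRHS]mulnCA leq_mul2l le1.
by rewrite [leqRHS]mulnCA mulnC leq_mul2l; apply/orP; right; lia.
Qed.

Theorem mainTheorem14 :
  forall R : rcfType, exists c : R,
  forall (d n : nat), (1 <= d)%N -> (2 * d <= n)%N ->
  forall (a : 'I_n -> 'rV[R]_d) (b : 'I_n -> R),
    (forall i, a i != 0) ->
    (forall i j : 'I_n, i != j -> ~ (forall x, hyp a b i x <-> hyp a b j x)) ->
    generic a b ->
  forall fr : forall j : nat, {set 'I_n} -> 'rV[R]_j -> 'rV[R]_d,
    good_frames a b fr ->
    num_prisms_le a b fr
      (c * 4 ^+ d / ((d%:R) ^+ 3 * Num.sqrt (d%:R)) * (n%:R) ^+ (2 * d)).
Proof.
(* [42 = 2 * 21]: the factor [2] of [words_le] times the constant in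
   [d^(7/2) <= d^4 <= 21 * 2^d]. *)
move=> R; exists 42 => d n d_gt0 dn a b _ _ gen fr frames m P prP distinct.
have le_m : (m <= 2 * 2 ^ d * n ^ (2 * d))%N.
  exact: leq_trans (card_prisms gen frames prP distinct) (words_le d_gt0 dn).
have d1 : (1 : R) <= d%:R by rewrite ler1n.
have sqrt_le : Num.sqrt (d%:R : R) <= d%:R.
  rewrite -[leRHS]ger0_norm // -sqrtr_sqr ler_sqrt ?exprn_ge0 // expr2.
  by rewrite -{1}[d%:R]mulr1 ler_wpM2l.
have den_gt0 : 0 < (d%:R : R) ^+ 3 * Num.sqrt d%:R.
  by rewrite mulr_gt0 ?exprn_gt0 ?sqrtr_gt0 // ltr0n.
rewrite mulrAC ler_pdivlMr //.
apply: le_trans (_ : (2 * 2 ^ d * n ^ (2 * d))%:R * d%:R ^+ 4 <= _).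
  apply: ler_pM => //; rewrite ?ler_nat // ?(ltW den_gt0) //.
  by rewrite [leRHS]exprSr ler_wpM2l // exprn_ge0.
have pow4 : (2 * 2 ^ d * n ^ (2 * d) * d ^ 4 <= 42 * 4 ^ d * n ^ (2 * d))%N.
  have -> : (4 ^ d = 2 ^ d * 2 ^ d)%N by rewrite -expnMn.
  rewrite mulnAC leq_mul2r; apply/orP; right.
  have -> : (42 * (2 ^ d * 2 ^ d) = 2 * 2 ^ d * (21 * 2 ^ d))%N by lia.
  by rewrite leq_mul2l pow4_le orbT.
by rewrite -natrX -natrM; move: pow4; rewrite -(ler_nat R) => /le_trans; apply;
  rewrite !natrM !natrX.
Qed.
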